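(* Let $D$ be an integral domain. The following are equivalent. (i) $D$ is a $b$-Noetherian integrally closed treed domain. (ii) $D$ is a $b$-Noetherian integrally closed DW-domain. (iii) $D$ is a Dedekind domain.
   Context: Let $D$ be an integral domain with quotient field $K$. An overring of $D$ is a ring $T$ with $D\subseteq T\subseteq K$; a valuation overring is an overring which is a valuation domain. For each nonzero $D$-submodule $E$ of $K$ set $E^b:=\bigcap\{EV \mid V \text{ valuation overring of } D\}$. A quasi-$b$-ideal of $D$ is a nonzero ideal $I$ of $D$ with $I^b\cap D=I$. $D$ is $b$-Noetherian if the ascending chain condition holds on quasi-$b$-ideals of $D$; equivalently, for each nonzero ideal $I$ of $D$ there is a finitely generated ideal $F\subseteq I$ with $F^b=I^b$. $D$ is treed if $\mathrm{Spec}(D)$, partially ordered by inclusion, is a tree (any two primes contained in a common prime are comparable). For nonzero $D$-submodules $E$ of $K$: $(D:E):=\{x\in K\mid xE\subseteq D\}$, $E^v:=(D:(D:E))$, $E^t:=\bigcup\{F^v\mid F\subseteq E,\ F\text{ nonzero finitely generated fractional ideal}\}$, $E^w:=\bigcap\{ED_Q\mid Q\in\mathrm{Max}^t(D)\}$ (an empty intersection being $K$), where $\mathrm{Max}^t(D)$ is the set of maximal elements among proper nonzero ideals $I$ of $D$ with $I^t=I$. $D$ is a DW-domain if $E^w=E$ for all $E$; equivalently, every (nonzero) maximal ideal $M$ of $D$ satisfies $M^t=M$. Fields are regarded as Dedekind domains. *)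

(* Defs.v *)
From HB Require Import structures.
From mathcomp Require Import all_boot all_order all_algebra.
From mathcomp Require Import boolp classical_sets.

Set Implicit Arguments.
Unset Strict Implicit.
Unset Printing Implicit Defensive.

Import GRing.Theory.
Local Open Scope ring_scope.
Local Open Scope classical_set_scope.

(* The quotient field of D is {fraction D}, with embedding tofrac.
   Ideals of D are sets of elements of D; D-submodules of the quotient field
   are sets of elements of {fraction D}; an ideal I of D is regarded as a
   submodule of the quotient field through its image tofrac @` I. *)

Section Ideals.
Variable D : idomainType.
Implicit Types I J P Q M : set D.

Definition is_ideal I : Prop :=
  [/\ I 0, forall x y, I x -> I y -> I (x + y) & forall a x, I x -> I (a * x)].

Definition proper_is_ideal I : Prop := is_ideal I /\ ~ I 1.

Definition is_prime_ideal P : Prop :=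
  proper_is_ideal P /\ forall x y, P (x * y) -> P x \/ P y.

Definition is_maximal_ideal M : Prop :=
  proper_is_ideal M /\ forall J, proper_is_ideal J -> M `<=` J -> J = M.

Definition acc_on (C : set (set D)) : Prop :=
  forall I : nat -> set D,
    (forall n, C (I n)) -> (forall n, I n `<=` I n.+1) ->
    exists N : nat, forall n, (N <= n)%N -> I n = I N.

Definition noetherian : Prop := acc_on is_ideal.

Definition treed : Prop :=
  forall P1 P2 P, is_prime_ideal P1 -> is_prime_ideal P2 -> is_prime_ideal P ->
    P1 `<=` P -> P2 `<=` P -> P1 `<=` P2 \/ P2 `<=` P1.

Definition integrally_closed : Prop :=
  forall x : {fraction D}, integralOver (@tofrac D) x -> range (@tofrac D) x.

(* Krull dimension at most one, so that fields are included. *)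
Definition dedekind : Prop :=
  [/\ noetherian, integrally_closed &
      forall P, is_prime_ideal P -> P <> [set 0] -> is_maximal_ideal P].

End Ideals.

Section Submodules.
Variable D : idomainType.
Local Notation K := {fraction D}.
Local Notation "x %:F" := (@tofrac D x) : ring_scope.
Implicit Types (E F T V : set K) (I J Q : set D).

Definition emb I : set K := @tofrac D @` I.

Definition is_submod E : Prop :=
  [/\ E 0, forall x y, E x -> E y -> E (x + y)
    & forall (a : D) x, E x -> E (a%:F * x)].

Definition nz_submod E : Prop := is_submod E /\ E <> [set 0].

(* Finite sums of products x * y with x in E and y in F. *)
Definition prodm E F : set K :=
  [set z | exists s : seq (K * K),
     (forall p, p \in s -> E p.1 /\ F p.2) /\ z = \sum_(p <- s) p.1 * p.2].

Definition Dspan (s : seq K) : set K :=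
  [set z | exists c : 'I_(size s) -> D, z = \sum_(i < size s) (c i)%:F * s`_i].

Definition fractional_ideal E : Prop :=
  is_submod E /\
  exists d : D, d != 0 /\ forall x, E x -> range (@tofrac D) (d%:F * x).

Definition fg_fractional_ideal F : Prop :=
  fractional_ideal F /\ exists s : seq K, F = Dspan s.

Definition overring T : Prop :=
  range (@tofrac D) `<=` T /\ subring_closed [in T].

(* The quotient field of an overring is again {fraction D}. *)
Definition valuation_overring V : Prop :=
  overring V /\ forall x : K, x != 0 -> V x \/ V x^-1.

Definition b_closure E : set K :=
  \bigcap_(V in valuation_overring) prodm E V.

Definition quasi_b_ideal I : Prop :=
  [/\ is_ideal I, I <> [set 0] & @tofrac D @^-1` b_closure (emb I) = I].

Definition colonD E : set K :=
  [set x | forall y, E y -> range (@tofrac D) (x * y)].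

Definition v_closure E : set K := colonD (colonD E).

Definition t_closure E : set K :=
  \bigcup_(F in [set F | [/\ fg_fractional_ideal F, F <> [set 0] & F `<=` E]])
    v_closure F.

Definition proper_t_ideal I : Prop :=
  [/\ proper_is_ideal I, I <> [set 0] & t_closure (emb I) = emb I].

Definition Max_t : set (set D) :=
  [set Q | proper_t_ideal Q /\ forall J, proper_t_ideal J -> Q `<=` J -> J = Q].

(* D_Q; used for Q in Max_t, where Q is a prime ideal. *)
Definition localization Q : set K :=
  [set x | exists a s : D, ~ Q s /\ x = a%:F / s%:F].

Definition w_closure E : set K :=
  \bigcap_(Q in Max_t) prodm E (localization Q).

End Submodules.

Definition b_noetherian (D : idomainType) : Prop :=
  acc_on (@quasi_b_ideal D).

Definition DW_domain (D : idomainType) : Prop :=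
  forall E : set {fraction D}, nz_submod E -> w_closure E = E.

(* Main.v *)
Require Import Defs.
From HB Require Import structures.
From mathcomp Require Import all_boot all_order all_algebra.
From mathcomp Require Import ring.
From mathcomp Require Import boolp classical_sets.

(** Write (D : I) for [colonD (emb I)].  All the work goes through one
    condition: every nonzero maximal ideal is a maximal t-ideal.

    This condition is equivalent to being a DW-domain
    ([DW_domain_of_Max_t], [Max_t_of_DW_domain]), because E is the intersection
    of the localizations E D_M at all maximal ideals M, and because M D_Q
    contains 1 as soon as M is not inside Q.  It holds in every treed domain
    ([treed_Max_t]): if M is maximal, the primes inside M that are minimal over
    a principal ideal form a chain, so every finite subset of M lies in a single
    one of them, and a finite subset s of a prime minimal over xD is multiplied
    into D by some y = h / x outside D.  Thus the v-closure of s does not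
    contain 1.

    Conversely, let D be b-Noetherian and integrally closed, so that D is the
    intersection of its valuation overrings
    ([mem_of_all_valuation_overrings]).  The b-closure of an ideal I is that of a
    finitely generated ideal F inside I; in a valuation overring V, F generates a
    principal ideal, hence I V is generated by an element of a fixed finite
    subset of I ([b_noetherian_locally_principal]).  There are two consequences.
    If x I is contained in I, then x lies in every V, hence in D
    ([b_noetherian_colon_self]): D is completely integrally closed.  And (D : I)
    is already determined by a finite subset of I
    ([b_noetherian_colon_finite]), so that for a maximal t-ideal M the module
    (D : M) is strictly larger than D.

    Now let every nonzero maximal ideal be a maximal t-ideal.  A nonzero ideal I
    is invertible ([ideal_invertible]): otherwise I (D : I) lies in a maximal
    ideal M, and any y in (D : M) maps (D : I) into itself, so y lies in D
    by complete integral closure, contradicting the previous paragraph.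
    Invertible ideals are divisorial, hence quasi-b-ideals, and the chain
    condition on quasi-b-ideals becomes the Noetherian property.  If P is a
    nonzero prime strictly inside a proper ideal J, then (D : J) maps P into
    itself, so it is contained in D, which contradicts the invertibility of J.
    Hence D is a Dedekind domain.  In a Dedekind domain two primes inside a common
    prime are comparable because nonzero primes are maximal. *)

Set Implicit Arguments.
Unset Strict Implicit.
Unset Printing Implicit Defensive.

Import GRing.Theory.
Local Open Scope ring_scope.
Local Open Scope classical_set_scope.

(** * Zorn's lemma above a given set *)

Lemma Zorn_above (T : Type) (P : set (set T)) (A0 : set T) : P A0 ->
  (forall F : set (set T), F !=set0 -> F `<=` P ->
     total_on F subset -> P (\bigcup_(X in F) X)) ->
  exists A, [/\ A0 `<=` A, P A & forall B, P B -> A `<=` B -> B = A].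
Proof.
move=> PA0 Pchain; case: (@Zorn_bigcup T [set X | P (A0 `|` X)]).
  move=> F FP Ftot /=; have [->|/set0P [X0 FX0]] := eqVneq F set0.
    by rewrite bigcup_set0 setU0.
  have -> : A0 `|` \bigcup_(X in F) X = \bigcup_(X in [set A0 `|` X | X in F]) X.
    apply/seteqP; split=> y.
      move=> [A0y|[X FX Xy]]; first by exists (A0 `|` X0); [exists X0|left].
      by exists (A0 `|` X); [exists X|right].
    by move=> [_ [X FX <-] [A0y|Xy]]; [left|right; exists X].
  apply: Pchain; first by exists (A0 `|` X0); exists X0.
    by move=> _ [X FX <-]; exact: FP.
  move=> _ _ [X FX <-] [Y FY <-].
  by have [XY|YX] := Ftot _ _ FX FY; [left|right]; exact: setUS.
move=> A [/= PA maxA]; exists (A0 `|` A); split=> // B PB AB.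
apply/seteqP; split=> // y By; apply: contrapT => Ay.
apply: (maxA B); last first.
  by rewrite /= (setUidPr _ _).2 //; apply: subset_trans AB; exact: subsetUl.
split; first by apply: subset_trans AB; exact: subsetUr.
by move=> BA; apply: Ay; right; exact: BA.
Qed.

Lemma total_on_directed (T : Type) (F : set (set T)) (X Y : set T) :
  total_on F subset -> F X -> F Y -> exists Z, [/\ F Z, X `<=` Z & Y `<=` Z].
Proof.
move=> Ftot FX FY.
by have [] := Ftot _ _ FX FY; [exists Y; split|exists X; split].
Qed.

(** * Valuation rings avoiding an element *)

Section SubringsOfFields.
Variable K : fieldType.
Implicit Types (x z : K).

Lemma subring_closed_setP (S : set K) :
  subring_closed [in S] <-> [/\ S 1, forall x y, S x -> S y -> S (x - y)
                                & forall x y, S x -> S y -> S (x * y)].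
Proof.
split=> -[S1 SB SM]; split.
- exact: set_mem.
- by move=> x y Sx Sy; apply/set_mem/SB; apply/mem_set.
- by move=> x y Sx Sy; apply/set_mem/SM; apply/mem_set.
- exact: mem_set.
- by move=> x y Sx Sy; apply/mem_set/SB; apply: set_mem.
- by move=> x y Sx Sy; apply/mem_set/SM; apply: set_mem.
Qed.

Lemma char_poly_over (S : subringClosed K) n (A : 'M[K]_n) :
  (forall i j, A i j \in S) -> char_poly A \is a polyOver S.
Proof.
move=> SA; rewrite /char_poly /determinant rpred_sum // => s _.
rewrite rpredMsign rpred_prod // => i _; rewrite !mxE rpredB //.
  by rewrite rpredMn ?polyOverX.
by rewrite polyOverC SA.
Qed.

(** Determinant trick: multiplication by x acts on the entries of v through a
    matrix over S, so x is a root of its characteristic polynomial. *)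
Lemma root_char_poly_of_stable_span (S : subringClosed K) n (v : 'cV[K]_n) x :
  v != 0 ->
  (forall i, exists c : 'I_n -> K,
     (forall j, c j \in S) /\ x * v i 0 = \sum_j c j * v j 0) ->
  exists r : {poly K}, [/\ r \is monic, r \is a polyOver S & root r x].
Proof.
move=> v0 /choice [c cP]; pose A : 'M[K]_n := \matrix_(i, j) c j i.
have SA i j : A i j \in S by rewrite mxE; case: (cP j).
exists (char_poly A); rewrite char_poly_monic char_poly_over //; split=> //.
rewrite -eigenvalue_root_char; apply/eigenvalueP; exists v^T; last first.
  by apply: contraNneq v0 => v0; rewrite -[v]trmxK v0 trmx0.
apply/rowP=> i; rewrite !mxE; have [_ ->] := cP i.
by apply: eq_bigr => j _; rewrite !mxE mulrC.
Qed.

(** The S-module spanned by 1, z, ..., z^N, where N is the sum of the sizes of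
    p and q, is stable under x: on a low power z^i the expansion of x in z
    stays within degree N, on a high power the expansion in 1/z stays within
    nonnegative degrees. *)
Lemma integral_of_two_expansions (S : subringClosed K) (p q : {poly K}) x z :
  z != 0 -> p \is a polyOver S -> q \is a polyOver S ->
  x = p.[z] -> x = q.[z^-1] ->
  exists r : {poly K}, [/\ r \is monic, r \is a polyOver S & root r x].
Proof.
move=> z0 Sp Sq xp xq; set m := size q; set N := (size p + m)%N.
pose v : 'cV[K]_N.+1 := \col_i z ^+ i.
apply: (@root_char_poly_of_stable_span S N.+1 v).
  by apply/eqP => /colP /(_ 0) /eqP; rewrite !mxE expr0 oner_eq0.
have span (r : {poly K}) y : r \is a polyOver S -> (size r <= N.+1)%N ->
    y = r.[z] -> exists c : 'I_N.+1 -> K, (forall j, c j \in S) /\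
      y = \sum_j c j * v j 0.
  move=> /polyOverP Sr sr ->; exists (fun j => r`_j); split=> //.
  rewrite (horner_coef_wide _ sr); apply: eq_bigr => j _; by rewrite mxE.
move=> i; have [im|mi] := leqP i m.
  apply: (span (p * 'X^i)); first by rewrite rpredM ?polyOverXn.
  - apply: (leq_trans (size_polyMleq _ _)); rewrite size_polyXn addnS /=.
    by rewrite leqW // leq_add2l.
  - by rewrite hornerM hornerXn mxE xp.
apply: (span (\sum_(j < m) q`_j *: 'X^(i - j))).
- rewrite rpred_sum // => j _; apply: polyOverZ; last exact: polyOverXn.
  by move/polyOverP: Sq.
- apply: (leq_trans (size_sum _ _ _)); apply/bigmax_leqP => j _.
  apply: (leq_trans (size_scale_leq _ _)); rewrite size_polyXn ltnS.
  by rewrite (leq_trans (leq_subr _ _)) // -ltnS.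
- rewrite horner_sum mxE xq horner_coef mulr_suml; apply: eq_bigr => j _.
  rewrite hornerZ hornerXn -mulrA; congr (_ * _).
  have ji : (j <= i)%N by rewrite ltnW // (ltn_trans _ mi).
  by rewrite -{1}(subnK ji) exprD exprVn mulrCA mulVf ?mulr1 // expf_neq0.
Qed.

(** Dividing the monic equation of degree n + 1 satisfied by x by x^n writes x
    as a polynomial in 1/x. *)
Lemma integral_inv_mem (S : subringClosed K) (r : {poly K}) x :
  r \is monic -> r \is a polyOver S -> root r x -> x^-1 \in S -> x \in S.
Proof.
move=> mr /polyOverP Sr /eqP rx Sx.
have [->|x0] := eqVneq x 0; first exact: rpred0.
have [n sr] : exists n, size r = n.+2.
  case E : (size r) => [|[|n]]; last by exists n.
  - move/eqP: E; rewrite size_poly_eq0 => /eqP r0.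
    by rewrite r0 monicE lead_coef0 eq_sym oner_eq0 in mr.
  - move: rx; rewrite horner_coef E big_ord1 expr0 mulr1 => r00.
    by move: mr; rewrite monicE /lead_coef E r00 eq_sym oner_eq0.
suff -> : x = - \sum_(i < n.+1) r`_i * x^-1 ^+ (n - i).
  by rewrite rpredN rpred_sum // => i _; rewrite rpredM ?rpredX.
have: r.[x] * x^-1 ^+ n = 0 by rewrite rx mul0r.
rewrite horner_coef sr big_ord_recr /=; move: mr.
rewrite monicE /lead_coef sr /= => /eqP ->; rewrite mul1r mulrDl.
rewrite exprS -[x * _ * _]mulrA -exprMn mulfV // expr1n mulr1 => /eqP.
rewrite addrC addr_eq0 => /eqP {1}->; congr (- _); rewrite mulr_suml.
apply: eq_bigr => i _; rewrite -mulrA; congr (_ * _).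
have ii : (i <= n)%N by rewrite -ltnS.
by rewrite exprB ?unitfE ?invr_neq0 // !exprVn invrK mulrC.
Qed.

Lemma adjoin_subring_closed (S : subringClosed K) z :
  subring_closed
    [in [set y | exists2 p : {poly K}, p \is a polyOver S & y = p.[z]]].
Proof.
split=> [|y1 y2|y1 y2]; rewrite !inE /=.
- by exists 1; rewrite ?rpred1 ?hornerC.
- by move=> [p Sp ->] [q Sq ->]; exists (p - q); rewrite ?rpredB ?hornerD ?hornerN.
- by move=> [p Sp ->] [q Sq ->]; exists (p * q); rewrite ?rpredM ?hornerM.
Qed.

(** Take a ring V maximal among those that contain S and avoid x. If both z
    and 1/z were outside V, then x would lie in V[z] and in V[1/z], hence be
    integral over V; as 1/x is in V, this forces x into V. *)
Lemma exists_valuation_subring_avoiding (S : set K) x :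
  subring_closed [in S] -> S x^-1 -> ~ S x ->
  exists V : set K, [/\ S `<=` V, subring_closed [in V],
    forall z, z != 0 -> V z \/ V z^-1 & ~ V x].
Proof.
move=> ringS Sx' Sx.
pose P (T : set K) := subring_closed [in T] /\ ~ T x.
have [|F [T0 FT0] FP Ftot|T [ST [ringT Tx] maxT]] := @Zorn_above K P S.
- by [].
- split; last by move=> [T FT Tx]; have [_] := FP _ FT; apply.
  apply/subring_closed_setP; split=> [|y1 y2|y1 y2].
  + by exists T0 => //; have [/subring_closed_setP []] := FP _ FT0.
  + move=> [T1 FT1 Ty1] [T2 FT2 Ty2].
    have [T [FT T1T T2T]] := total_on_directed Ftot FT1 FT2; exists T => //.
    have [/subring_closed_setP [_ B _] _] := FP _ FT.
    by apply: B; [exact: T1T|exact: T2T].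
  + move=> [T1 FT1 Ty1] [T2 FT2 Ty2].
    have [T [FT T1T T2T]] := total_on_directed Ftot FT1 FT2; exists T => //.
    have [/subring_closed_setP [_ _ M] _] := FP _ FT.
    by apply: M; [exact: T1T|exact: T2T].
exists T; split=> //.
pose V : subringClosed K :=
  HB.pack (fun y => y \in T) (GRing.isSubringClosed.Build _ _ ringT).
(* By maximality, adjoining any further element captures x. *)
have exp z : ~ T z -> exists2 p : {poly K}, p \is a polyOver V & x = p.[z].
  move=> Tz; apply: contrapT => nx; apply: Tz.
  pose W := [set y | exists2 p : {poly K}, p \is a polyOver V & y = p.[z]].
  have TW : T `<=` W.
    move=> y Vy; exists y%:P; last by rewrite hornerC.
    by rewrite polyOverC; apply: mem_set.
  rewrite -(maxT W _ TW); first by exists 'X; rewrite ?polyOverX ?hornerX.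
  by split=> //; exact: (adjoin_subring_closed V).
move=> z z0; have [|Vz] := pselect (T z); first by left.
right; apply: contrapT => Vz'; have [p Vp xp] := exp _ Vz.
have [q Vq xq] := exp _ Vz'.
have [r [mr Vr rx]] := integral_of_two_expansions z0 Vp Vq xp xq.
apply: Tx; apply: set_mem; apply: (integral_inv_mem (S := V) mr Vr rx).
by apply: mem_set; exact: ST.
Qed.

End SubringsOfFields.

(** * Integrally closed domains are intersections of valuation overrings *)

Section ValuationOverrings.
Variable D : idomainType.
Local Notation K := {fraction D}.
Local Notation "x %:F" := (@tofrac D x) : ring_scope.
Implicit Types (V : set K) (x : K).

Lemma range_tofrac_subring : subring_closed [in range (@tofrac D)].
Proof.
split=> [|x y|x y]; rewrite !inE; first by exists 1; rewrite ?tofrac1.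
- by move=> [a _ <-] [b _ <-]; exists (a - b); rewrite ?tofracB.
- by move=> [a _ <-] [b _ <-]; exists (a * b); rewrite ?tofracM.
Qed.

Lemma integralOver_of_monic_range (r : {poly K}) x :
  (forall i, range (@tofrac D) r`_i) -> r \is monic -> root r x ->
  integralOver (@tofrac D) x.
Proof.
move=> rD mr rx.
have /choice [f fP] i : exists a, a%:F = r`_i by have [a _] := rD i; exists a.
exists (\poly_(i < size r) f i); last first.
  suff -> : map_poly (@tofrac D) (\poly_(i < size r) f i) = r by [].
  apply/polyP => i; rewrite coef_map coef_poly.
  case: ltnP => [|sr] /=; first by rewrite fP.
  by rewrite /= tofrac0 nth_default.
have s0 : (0 < size r)%N by rewrite size_poly_gt0 monic_neq0.
have f1 : f (size r).-1 = 1.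
  apply/eqP; rewrite -tofrac_eq tofrac1; apply/eqP.
  by have /(_ (size r).-1) := fP; move/monicP: mr; rewrite /lead_coef => ->.
by rewrite monicE lead_coef_poly // ?f1 // oner_neq0.
Qed.

(** An element x outside the integrally closed domain D is outside D[1/x] as
    well, for x = p(1/x) is an integral equation for x over D. So some
    valuation overring of D[1/x] avoids x. *)
Lemma mem_of_all_valuation_overrings x : integrally_closed D ->
  (forall V, valuation_overring V -> V x) -> range (@tofrac D) x.
Proof.
move=> icD allV; have [//|Dx] := pselect (range (@tofrac D) x).
have x0 : x != 0.
  by apply/eqP => x0; apply: Dx; rewrite x0; exists 0; rewrite ?tofrac0.
pose S : subringClosed K := HB.pack (fun y => y \in range (@tofrac D))
   (GRing.isSubringClosed.Build _ _ range_tofrac_subring).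
pose W := [set y | exists2 p : {poly K}, p \is a polyOver S & y = p.[x^-1]].
have DW : range (@tofrac D) `<=` W.
  move=> y Dy; exists y%:P; last by rewrite hornerC.
  by rewrite polyOverC; apply: mem_set.
have Wx' : W x^-1 by exists 'X; rewrite ?polyOverX ?hornerX.
have Wx : ~ W x.
  move=> [p Sp xp].
  have xX : x = 'X.[x^-1^-1] by rewrite hornerX invrK.
  have [r [mr /polyOverP Sr rx]] :=
    integral_of_two_expansions (invr_neq0 x0) Sp (polyOverX S) xp xX.
  apply: Dx; apply: icD; apply: (integralOver_of_monic_range _ mr rx) => i.
  exact: set_mem (Sr i).
have [V [WV ringV valV Vx]] :=
  exists_valuation_subring_avoiding (adjoin_subring_closed S x^-1) Wx' Wx.
case: Vx; apply: allV; split=> //; split=> //; exact: subset_trans WV.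
Qed.

End ValuationOverrings.

(** * Products of submodules, overrings and ideals *)

Section Products.
Variable D : idomainType.
Local Notation K := {fraction D}.
Local Notation "x %:F" := (@tofrac D x) : ring_scope.
Implicit Types (E F G V : set K) (I : set D) (a x y z : K).

Lemma prodm_sub E F G : G 0 -> (forall x y, G x -> G y -> G (x + y)) ->
  (forall x y, E x -> F y -> G (x * y)) -> prodm E F `<=` G.
Proof.
move=> G0 GD GM z [s [sP ->]]; rewrite big_seq; elim/big_ind: _ => // p /sP.
by case; exact: GM.
Qed.

Lemma mem_prodm E F x y : E x -> F y -> prodm E F (x * y).
Proof.
move=> Ex Fy; exists [:: (x, y)]; rewrite big_seq1; split=> // p.
by rewrite inE => /eqP ->.
Qed.

Lemma prodm0 E F : prodm E F 0.
Proof. by exists [::]; rewrite big_nil. Qed.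

Lemma prodmD E F x y : prodm E F x -> prodm E F y -> prodm E F (x + y).
Proof.
move=> [s [sP ->]] [t [tP ->]]; exists (s ++ t); rewrite big_cat; split=> // p.
by rewrite mem_cat => /orP [/sP|/tP].
Qed.

Lemma prodm_scale E F a z : (forall y, F y -> F (a * y)) ->
  prodm E F z -> prodm E F (a * z).
Proof.
move=> Fa; apply: (@prodm_sub E F [set z | prodm E F (a * z)]) => /=.
- by rewrite mulr0; exact: prodm0.
- by move=> x y Ex Ey; rewrite mulrDr; exact: prodmD.
- by move=> x y Ex Fy; rewrite mulrCA; apply: mem_prodm => //; exact: Fa.
Qed.

Lemma overring_closed (T : set K) : overring T ->
  [/\ forall d, T d%:F, T 0, T 1, forall x y, T x -> T y -> T (x + y)
    & forall x y, T x -> T y -> T (x * y)].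
Proof.
move=> [DT /subring_closed_setP [T1 TB TM]].
have TD d : T d%:F by apply: DT; exists d.
have T0 : T 0 by rewrite -(tofrac0 D).
split=> // x y Tx Ty; rewrite -[y]opprK -[- y]sub0r; apply: (TB) => //.
exact: TB.
Qed.

Lemma range_tofrac_closed : [/\ range (@tofrac D) 0, range (@tofrac D) 1,
  forall x y, range (@tofrac D) x -> range (@tofrac D) y ->
    range (@tofrac D) (x + y)
  & forall x y, range (@tofrac D) x -> range (@tofrac D) y ->
    range (@tofrac D) (x * y)].
Proof.
by have [] := @overring_closed (range (@tofrac D))
  (conj (fun _ => id) (range_tofrac_subring D)).
Qed.

Lemma exists_nonzero I : is_ideal I -> I <> [set 0] -> exists2 d, I d & d != 0.
Proof.
move=> [I0 _ _] In0; apply: contrapT => h; apply: In0.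
apply/seteqP; split=> [d Id|d ->] //=; apply: contrapT => /eqP d0.
by apply: h; exists d.
Qed.

Lemma nonzero_ideal I d : I d -> d != 0 -> I <> [set 0].
Proof. by move=> Id /eqP d0 I0; apply: d0; rewrite I0 in Id. Qed.

Lemma is_submod_emb I : is_ideal I -> is_submod (emb I).
Proof.
move=> [I0 ID IM]; split.
- by exists 0; rewrite ?tofrac0.
- by move=> _ _ [a Ia <-] [b Ib <-]; exists (a + b); [exact: ID|rewrite tofracD].
- by move=> c _ [a Ia <-]; exists (c * a); [exact: IM|rewrite tofracM].
Qed.

Lemma emb_mem I d : emb I d%:F <-> I d.
Proof.
split=> [[e Ie /eqP]|Id]; last by exists d.
by rewrite tofrac_eq => /eqP <-.
Qed.

End Products.

(** * The b-closure and b-Noetherian domains *)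

Section BClosure.
Variable D : idomainType.
Local Notation K := {fraction D}.
Local Notation "x %:F" := (@tofrac D x) : ring_scope.
Implicit Types (E V : set K) (I J A : set D) (s : seq D) (x y z : K).

Definition quasi_b_closure I : set D := @tofrac D @^-1` b_closure (emb I).

Lemma sub_quasi_b_closure I : I `<=` quasi_b_closure I.
Proof.
move=> d Id V [/overring_closed [_ _ V1 _ _] _]; rewrite -[_%:F]mulr1.
by apply: mem_prodm => //; exists d.
Qed.

Lemma quasi_b_closure_mono I J : I `<=` J ->
  quasi_b_closure I `<=` quasi_b_closure J.
Proof.
move=> IJ d Id V /[dup] valV /Id; apply: prodm_sub; first exact: prodm0.
  by move=> *; apply: prodmD.
by move=> _ y [a /IJ Ja <-] Vy; apply: mem_prodm => //; exists a.
Qed.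

(** Extending to V the trace on D of the intersection of all the I V gives
    back at most I V, so closing a second time adds nothing. *)
Lemma quasi_b_closureP I : is_ideal I -> I <> [set 0] ->
  quasi_b_ideal (quasi_b_closure I).
Proof.
move=> idI /(exists_nonzero idI) [d Id d0]; split.
- split=> [|a b Ia Ib|a b Ib] V valV.
  + by rewrite tofrac0; exact: prodm0.
  + by rewrite tofracD; apply: prodmD; [exact: Ia|exact: Ib].
  + have [/overring_closed [DV _ _ _ VM] _] := valV.
    by rewrite tofracM; apply: prodm_scale (Ib _ valV) => y Vy; exact: VM.
- exact: (nonzero_ideal (sub_quasi_b_closure Id) d0).
- apply/seteqP; split; last exact: sub_quasi_b_closure.
  move=> e Ie V valV; have [/overring_closed [_ _ _ _ VM] _] := valV.
  apply: prodm_sub (Ie _ valV); first exact: prodm0.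
    by move=> *; apply: prodmD.
  move=> _ y [j Ij <-] Vy; rewrite mulrC; apply: prodm_scale (Ij _ valV) => v Vv.
  exact: VM.
Qed.

Definition ideal_gen A : set D :=
  [set d | forall J, is_ideal J -> A `<=` J -> J d].

Lemma is_ideal_gen A : is_ideal (ideal_gen A).
Proof.
split=> [|x y Ax Ay|a x Ax] J idJ AJ; have [J0 JD JM] := idJ => //.
  by apply: JD; [exact: Ax|exact: Ay].
by apply: JM; exact: Ax.
Qed.

(** Otherwise one adjoins forever a new element of I lying outside the closure
    of the ideal generated by the previous ones, and the closures increase
    strictly. *)
Lemma b_noetherian_finite_type I : b_noetherian D -> is_ideal I ->
  exists s, [set` s] `<=` I /\ I `<=` quasi_b_closure (ideal_gen [set` s]).
Proof.
move=> bN idI; apply: contrapT => nfin.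
have In0 : I <> [set 0].
  move=> I0; apply: nfin; exists [::]; split; first by move=> ?.
  rewrite I0 => _ ->; apply: sub_quasi_b_closure.
  by have [] := is_ideal_gen [set` [::]].
have [d0 Id0 d00] := exists_nonzero idI In0.
have /choice [next nextP] : forall s, exists d, [set` s] `<=` I ->
    I d /\ ~ quasi_b_closure (ideal_gen [set` s]) d.
  move=> s; have [sI|nsI] := pselect ([set` s] `<=` I); last by exists 0.
  apply: contrapT => nd; apply: nfin; exists s; split=> // d Id.
  by apply: contrapT => nId; apply: nd; exists d.
pose u n := iter n (fun s => next s :: s) [:: d0].
have uI n : [set` u n] `<=` I.
  elim: n => [|n IHn] d /=; rewrite inE; first by move/eqP ->.
  by move=> /orP [/eqP ->|]; [have [] := nextP _ IHn|exact: IHn].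
have d0u n : ideal_gen [set` u n] d0.
  move=> J _; apply; elim: n => [|n IHn] /=; first by rewrite inE.
  by rewrite inE IHn orbT.
have [|n|N /(_ N.+1 (leqnSn N)) JN] :=
    bN (fun n => quasi_b_closure (ideal_gen [set` u n])).
- move=> n; apply: quasi_b_closureP; first exact: is_ideal_gen.
  exact: nonzero_ideal (d0u n) d00.
- apply: quasi_b_closure_mono => d Ad J idJ uJ; apply: Ad => // e ue.
  by apply: uJ; rewrite /= inE [_ \in _]ue orbT.
have [_] := nextP _ (uI N); rewrite -JN; apply; apply: sub_quasi_b_closure.
by move=> J _; apply; rewrite /= mem_head.
Qed.

(** Divisibility in V is total, so a finite family has an element dividing all
    the others. As d is nonzero, so is such an element. *)
Lemma valuation_overring_dominant V (d : D) s : valuation_overring V -> d != 0 ->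
  exists f, [/\ f \in d :: s, f != 0 & forall g, g \in d :: s -> V (g%:F / f%:F)].
Proof.
move=> [/overring_closed [_ V0 V1 _ VM] valV] d0; elim: s => [|e s [f [fs f0 fP]]].
  exists d; rewrite mem_head d0; split=> // g; rewrite inE => /eqP ->.
  by rewrite divff // tofrac_eq0.
have sub g : g \in d :: s -> g \in [:: d, e & s].
  by rewrite !inE => /orP [->|->]; rewrite ?orbT.
have split3 g : g \in [:: d, e & s] -> g = e \/ g \in d :: s.
  by rewrite !inE => /or3P [->|/eqP|->]; rewrite ?orbT; [right|left|right].
have [e0|e0] := eqVneq e 0.
  exists f; split=> [||g /split3 [->|/fP]] //; first exact: sub.
  by rewrite e0 tofrac0 mul0r.
have [|Vef|Vfe] := valV (e%:F / f%:F).
- by rewrite mulf_neq0 ?invr_neq0 ?tofrac_eq0.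
- by exists f; split=> [||g /split3 [->|/fP]] //; exact: sub.
exists e; split=> // [|g /split3 [->|/fP Vg]]; first by rewrite !inE eqxx orbT.
  by rewrite divff // tofrac_eq0.
have -> : g%:F / e%:F = (g%:F / f%:F) * (e%:F / f%:F)^-1.
  by rewrite invf_div mulrA divfK // tofrac_eq0.
exact: VM.
Qed.

(** The list s is chosen before V: only the generator f of I V among its
    entries depends on V. *)
Lemma b_noetherian_locally_principal I : b_noetherian D ->
  is_ideal I -> I <> [set 0] ->
  exists s, [set` s] `<=` I /\ forall V, valuation_overring V ->
    exists f, [/\ f \in s, f != 0 & forall d, I d -> V (d%:F / f%:F)].
Proof.
move=> bN idI In0; have [d0 Id0 d00] := exists_nonzero idI In0.
have [s [sI Is]] := b_noetherian_finite_type bN idI.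
exists (d0 :: s); split=> [d /=|V valV].
  by rewrite inE => /orP [/eqP ->|/sI].
have [f [fs f0 fP]] := valuation_overring_dominant s valV d00.
exists f; split=> // d /Is /(_ V valV).
have [/overring_closed [DV V0 V1 VD VM] _] := valV.
apply: (@prodm_sub _ _ _ [set z | V (z / f%:F)]) => /=.
- by rewrite mul0r.
- by move=> x y Vx Vy; rewrite mulrDl; exact: VD.
move=> _ y [a Aa <-] Vy; rewrite mulrAC; apply: (VM) => //.
apply: (Aa [set a | V (a%:F / f%:F)]) => /=; last first.
  by move=> g gs; apply: fP; rewrite inE [g \in s]gs orbT.
split=> /= [|x z Vx Vz|b x Vx]; first by rewrite tofrac0 mul0r.
  by rewrite tofracD mulrDl; exact: VD.
by rewrite tofracM -mulrA; apply: VM.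
Qed.

(** If f generates I V, then x f is in I, hence in f V, and x is in V. *)
Lemma b_noetherian_colon_self I x : b_noetherian D -> integrally_closed D ->
  is_ideal I -> I <> [set 0] ->
  (forall d, I d -> emb I (x * d%:F)) -> range (@tofrac D) x.
Proof.
move=> bN icD idI In0 xI; have [s [sI sP]] := b_noetherian_locally_principal bN idI In0.
apply: mem_of_all_valuation_overrings => // V /sP [f [fs f0 fP]].
have [e Ie eE] := xI f (sI f fs).
by have := fP e Ie; rewrite eE mulfK // tofrac_eq0.
Qed.

(** If f generates I V and y f is in D, then y I is contained in y f V, hence
    in V. *)
Lemma b_noetherian_colon_finite I : b_noetherian D -> integrally_closed D ->
  is_ideal I -> I <> [set 0] ->
  exists s, [set` s] `<=` I /\ forall y,
    (forall f, f \in s -> range (@tofrac D) (y * f%:F)) -> colonD (emb I) y.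
Proof.
move=> bN icD idI In0; have [s [sI sP]] := b_noetherian_locally_principal bN idI In0.
exists s; split=> // y ys _ [d Id <-].
apply: mem_of_all_valuation_overrings => // V valV.
have [f [fs f0 fP]] := sP _ valV.
have [/overring_closed [DV _ _ _ VM] _] := valV.
have -> : y * d%:F = (y * f%:F) * (d%:F / f%:F).
  by rewrite mulrA mulrAC mulfK // tofrac_eq0.
by apply: VM; [have [c _ <-] := ys f fs|exact: fP].
Qed.

End BClosure.

(** * Maximal ideals and primes minimal over a principal ideal *)

Section MaximalIdeals.
Variable D : idomainType.
Implicit Types (I J M P Q : set D) (x y a b f g h : D) (s : seq D).

Lemma exists_maximal_ideal I : proper_is_ideal I ->
  exists M, I `<=` M /\ is_maximal_ideal M.
Proof.
move=> propI; have [|F [J0 FJ0] FP Ftot|M [IM propM maxM]] :=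
  @Zorn_above _ (@proper_is_ideal D) I.
- by [].
- split; last by move=> [J FJ J1]; have [] := FP _ FJ.
  split.
  + by exists J0 => //; have [[]] := FP _ FJ0.
  + move=> x y [J1 FJ1 J1x] [J2 FJ2 J2y].
    have [J [FJ J1J J2J]] := total_on_directed Ftot FJ1 FJ2; exists J => //.
    by have [[_ JD _] _] := FP _ FJ; apply: JD; [exact: J1J|exact: J2J].
  + by move=> a x [J FJ Jx]; exists J => //; have [[_ _ JM] _] := FP _ FJ; apply: JM.
- by exists M; split.
Qed.

Lemma maximal_ideal_bezout M x : is_maximal_ideal M -> ~ M x ->
  exists m a, M m /\ m + a * x = 1.
Proof.
move=> [[[M0 MD MM] M1] maxM] Mx; apply: contrapT => nbez.
pose J := [set y | exists m a, M m /\ m + a * x = y].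
apply: Mx; rewrite -(maxM J).
- by exists 0, 1; rewrite add0r mul1r.
- split=> //; split.
  + by exists 0, 0; rewrite mul0r addr0.
  + move=> _ _ [m [a [Mm <-]]] [n [b [Mn <-]]]; exists (m + n), (a + b).
    by split; [exact: MD|rewrite mulrDl addrACA].
  + move=> c _ [m [a [Mm <-]]]; exists (c * m), (c * a).
    by split; [exact: MM|rewrite mulrDr mulrA].
- by move=> m Mm; exists m, 0; rewrite mul0r addr0.
Qed.

Lemma maximal_is_prime M : is_maximal_ideal M -> is_prime_ideal M.
Proof.
move=> maxM; have [[[M0 MD MM] M1] _] := maxM; split=> // x y Mxy.
have [Mx|/(maximal_ideal_bezout maxM) [m [a [Mm e]]]] := pselect (M x); first by left.
right; rewrite -[y]mul1r -e mulrDl -mulrA.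
by apply: MD; [rewrite mulrC|]; exact: MM.
Qed.

(** P is the complement of a multiplicative set T that is maximal among those
    that contain the complement of M and avoid xD, so P is minimal over xD.
    The last clause records the form of minimality used below: the powers of f
    become multiples of x after localizing at P. It comes from the maximality
    of T, as the multiplicative set generated by T and f has to meet xD, and
    it is also what makes P closed under addition. *)
Lemma exists_minimal_prime M x : is_prime_ideal M -> M x ->
  exists P, [/\ is_prime_ideal P, P `<=` M, P x &
    forall f, P f -> exists h n c, ~ P h /\ h * f ^+ n = c * x].
Proof.
move=> [[[M0 MD MM] M1] Mprime] Mx.
pose mult_avoiding (T : set D) :=
  [/\ T 1, forall a b, T a -> T b -> T (a * b) & forall c, ~ T (c * x)].
have [|F [T0 FT0] FP Ftot|T [MT [T1 TM Tx] maxT]] :=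
  @Zorn_above _ mult_avoiding (~` M).
- split=> // [a b Ma Mb /Mprime []//|c]; apply; exact: MM.
- split.
  + by exists T0 => //; have [] := FP _ FT0.
  + move=> a b [T1 FT1 T1a] [T2 FT2 T2b].
    have [T [FT T1T T2T]] := total_on_directed Ftot FT1 FT2; exists T => //.
    by have [_ TM _] := FP _ FT; apply: TM; [exact: T1T|exact: T2T].
  + by move=> c [T FT Tcx]; have [_ _ /(_ c)] := FP _ FT.
have wit f : ~ T f -> exists h n c, T h /\ h * f ^+ n = c * x.
  move=> Tf; apply: contrapT => nwit; apply: Tf.
  rewrite -(maxT [set y | exists h n, T h /\ h * f ^+ n = y]).
  - by exists 1, 1%N; rewrite mul1r expr1.
  - split.
    + by exists 1, 0%N; rewrite mulr1.
    + move=> _ _ [h [n [Th <-]]] [k [m [Tk <-]]]; exists (h * k), (n + m)%N.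
      by split; [exact: TM|rewrite exprD mulrACA].
    + by move=> c [h [n [Th e]]]; apply: nwit; exists h, n, c.
  - by move=> h Th; exists h, 0%N; rewrite mulr1.
have notT h c : h = c * x -> ~ T h by move=> ->; exact: Tx.
have TX f n : T f -> T (f ^+ n).
  by move=> Tf; elim: n => [|n IHn]; rewrite ?expr0 // exprS; exact: TM.
exists (~` T); split.
- split; last first.
    by move=> a b Tab; apply/not_andP => -[Ta Tb]; apply: Tab; exact: TM.
  split; last by apply.
  split.
  + by apply: (notT _ 0); rewrite mul0r.
  + move=> f g /wit [h [n [c [Th hf]]]] /wit [k [m [e [Tk kg]]]] /(TX _ (n + m)%N).
    move=> /(TM _ _ (TM _ _ Th Tk)).
    suff [d ->] : exists d, h * k * (f + g) ^+ (n + m) = d * x by exact: Tx.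
    rewrite exprDn mulr_sumr.
    elim/big_ind: _ => [|_ _ [a ->] [b ->]|i _].
    * by exists 0; rewrite mul0r.
    * by exists (a + b); rewrite mulrDl.
    (* Each monomial contains f^n or g^m. *)
    have [im|mi] := leqP i m.
      have -> : (n + m - i = n + (m - i))%N by rewrite addnBA.
      exists (c * (k * f ^+ (m - i) * g ^+ i *+ 'C(n + m, i))).
      by rewrite exprD -[RHS]mulrAC -hf; ring.
    have -> : g ^+ i = g ^+ m * g ^+ (i - m) by rewrite -exprD subnKC // ltnW.
    exists (e * (h * f ^+ (n + m - i) * g ^+ (i - m) *+ 'C(n + m, i))).
    by rewrite -[RHS]mulrAC -kg; ring.
  + move=> a f /wit [h [n [c [Th hf]]]] /(TX _ n) /(TM _ _ Th).
    by apply: (notT _ (a ^+ n * c)); rewrite exprMn mulrCA hf mulrA.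
- by move=> y Ty; apply: contrapT => My; apply: Ty; exact: MT.
- by apply: (notT _ 1); rewrite mul1r.
- move=> f /wit [h [n [c [Th hf]]]]; exists h, n, c; split=> //; exact.
Qed.

(** Multiply h, for each f in s in turn, by the largest power of f that keeps
    the product outside xD; one more factor f then falls into xD. *)
Lemma residual_of_radical x s h :
  (forall c, h <> c * x) ->
  (forall f, f \in s -> exists n c, h * f ^+ n = c * x) ->
  exists a, (forall c, a * h <> c * x) /\
    forall f, f \in s -> exists c, a * h * f = c * x.
Proof.
elim: s h => [|f s IHs] h hx hs.
  by exists 1; split=> // c; rewrite mul1r.
have hf : exists n, `[< exists c, h * f ^+ n = c * x >].
  have [|n [c e]] := hs f; first exact: mem_head.
  by exists n; apply/asboolP; exists c.
case: (ex_minnP hf) => -[|n] /asboolP [c e] minn.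
  by case: (hx c); rewrite -e mulr1.
have [d|g gs|a [ax as_]] := IHs (h * f ^+ n).
- move=> e'; suff : (n < n)%N by rewrite ltnn.
  by apply: minn; apply/asboolP; exists d.
- have [|m [d e']] := hs g; first by rewrite inE gs orbT.
  by exists m, (d * f ^+ n); rewrite mulrAC e' mulrAC.
exists (a * f ^+ n); split=> [d|g].
  by rewrite -mulrA [f ^+ n * h]mulrC; exact: ax.
rewrite inE => /orP [/eqP ->|/as_ [d e']].
  by exists (a * c); rewrite -[RHS]mulrA -e exprS; ring.
by exists d; rewrite -e'; ring.
Qed.

(** Primes inside M form a chain, so whenever a new element a of s is not in
    the prime found so far, a prime minimal over a contains that prime. *)
Lemma treed_finite_subset M s : treed D -> is_prime_ideal M -> M <> [set 0] ->
  [set` s] `<=` M ->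
  exists P x, [/\ is_prime_ideal P, P `<=` M, P x, x != 0 &
    [set` s] `<=` P] /\
    forall f, P f -> exists h n c, ~ P h /\ h * f ^+ n = c * x.
Proof.
move=> treedD primeM Mn0; have [[idM _] _] := primeM.
elim: s => [|a s IHs] sM.
  have [x Mx x0] := exists_nonzero idM Mn0.
  by have [P [primeP PM Px minP]] := exists_minimal_prime primeM Mx; exists P, x.
have [b bs|P [x [[primeP PM Px x0 sP] minP]]] := IHs.
  by apply: sM; rewrite /= inE [_ \in _]bs orbT.
have [Pa|Pa] := pselect (P a).
  exists P, x; split=> //; split=> // b /=.
  by rewrite inE => /orP [/eqP ->|/sP].
have Ma : M a by apply: sM; rewrite /= mem_head.
have a0 : a != 0.
  by apply/eqP => a0; apply: Pa; rewrite a0; have [[[]]] := primeP.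
have [Q [primeQ QM Qa minQ]] := exists_minimal_prime primeM Ma.
have [PQ|/(_ a Qa)//] := treedD _ _ _ primeP primeQ primeM PM QM.
exists Q, a; split=> //; split=> // b /=.
by rewrite inE => /orP [/eqP ->|/sP /PQ].
Qed.

End MaximalIdeals.

(** * Maximal t-ideals, treed domains and DW-domains *)

Section MaximalTIdeals.
Variable D : idomainType.
Local Notation K := {fraction D}.
Local Notation "x %:F" := (@tofrac D x) : ring_scope.
Implicit Types (E V : set K) (I J M Q : set D) (s : seq D) (x y z : K).

Lemma mem_Dspan (t : seq K) x : x \in t -> Dspan t x.
Proof.
move=> xt; pose i := Ordinal (etrans (index_mem x t) xt : index x t < size t)%N.
exists (fun j => (j == i)%:R); rewrite (bigD1 i) //= eqxx big1 => [|j /negbTE ->].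
  by rewrite addr0 tofrac1 mul1r nth_index.
by rewrite tofrac0 mul0r.
Qed.

Lemma Dspan_sub (t : seq K) E : is_submod E -> (forall x, x \in t -> E x) ->
  Dspan t `<=` E.
Proof.
move=> [E0 ED EM] tE _ [c ->]; elim/big_ind: _ => // i _.
by apply: EM; apply: tE; exact: mem_nth.
Qed.

Lemma is_submod_Dspan (t : seq K) : is_submod (Dspan t).
Proof.
split=> [|_ _ [c ->] [e ->]|a _ [c ->]].
- by exists (fun _ => 0); rewrite big1 // => i _; rewrite tofrac0 mul0r.
- exists (fun i => c i + e i); rewrite -big_split; apply: eq_bigr => i _.
  by rewrite tofracD mulrDl.
- exists (fun i => a * c i); rewrite mulr_sumr; apply: eq_bigr => i _.
  by rewrite tofracM mulrA.
Qed.

Lemma is_submod_colonD E : is_submod (colonD E).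
Proof.
have [R0 R1 RD RM] := range_tofrac_closed D.
split=> [y _|x y xE yE z Ez|a x xE y Ey].
- by rewrite mul0r.
- by rewrite mulrDl; apply: RD; [exact: xE|exact: yE].
- by rewrite -mulrA; apply: RM; [exists a|exact: xE].
Qed.

Lemma sub_v_closure E : E `<=` v_closure E.
Proof. by move=> x Ex y /(_ x Ex); rewrite mulrC. Qed.

Lemma colonD_Dspan (t : seq K) y :
  (forall x, x \in t -> range (@tofrac D) (y * x)) -> colonD (Dspan t) y.
Proof.
move=> ty x /(Dspan_sub (E := [set x | range (@tofrac D) (y * x)])); apply=> //=.
have [R0 R1 RD RM] := range_tofrac_closed D.
split=> /= [|u v yu yv|a u yu]; first by rewrite mulr0.
  by rewrite mulrDr; exact: RD.
by rewrite mulrCA; apply: RM => //; exists a.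
Qed.

Lemma fg_fractional_Dspan s :
  fg_fractional_ideal (Dspan (map (@tofrac D) s)).
Proof.
split; last by exists (map (@tofrac D) s).
split; first exact: is_submod_Dspan.
exists 1; rewrite oner_neq0; split=> // x; rewrite tofrac1 mul1r.
have [R0 R1 RD RM] := range_tofrac_closed D.
apply: Dspan_sub => [|_ /mapP [a _ ->]]; last by exists a.
by split=> // a u Ru; apply: RM => //; exists a.
Qed.

(** Otherwise 1 lies in the v-closure of the finitely generated ideal spanned
    by s. A nonzero m in I is added to s because s could be empty or zero,
    whereas the t-closure is built from nonzero submodules. *)
Lemma proper_t_ideal_colon I s : proper_t_ideal I -> [set` s] `<=` I ->
  exists y, ~ range (@tofrac D) y /\
    forall f, f \in s -> range (@tofrac D) (y * f%:F).
Proof.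
move=> [[idI I1] In0 tI] sI; apply: contrapT => ny; apply: I1.
have [m Im m0] := exists_nonzero idI In0.
apply/emb_mem; rewrite -tI tofrac1.
pose t := map (@tofrac D) (m :: s); exists (Dspan t).
  have tm : Dspan t m%:F by apply: mem_Dspan; exact: mem_head.
  split; first exact: fg_fractional_Dspan.
    move=> t0; rewrite t0 in tm; move/eqP: tm.
    by rewrite tofrac_eq0 (negbTE m0).
  apply: Dspan_sub => [|_ /mapP [a ams ->]]; first exact: is_submod_emb.
  apply/emb_mem; move: ams; rewrite inE => /orP [/eqP -> //|]; exact: sI.
move=> y yt; rewrite mul1r; apply: contrapT => Dy; apply: ny.
exists y; split=> // f fs; apply: yt; apply: mem_Dspan.
by apply: map_f; rewrite inE fs orbT.
Qed.

(** If an element c outside M were in the v-closure of a finitely generated F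
    inside M, write 1 = m + a c with m in M: a multiplier y of m and F into D
    would satisfy y = y m + a (y c), hence lie in D. *)
Lemma maximal_Max_t M : is_maximal_ideal M -> M <> [set 0] ->
  (forall s, [set` s] `<=` M -> exists y, ~ range (@tofrac D) y /\
    forall f, f \in s -> range (@tofrac D) (y * f%:F)) ->
  Max_t M.
Proof.
move=> maxM Mn0 colonM; have [[idM M1] topM] := maxM.
have [R0 R1 RD RM] := range_tofrac_closed D.
split; last by move=> J [propJ _ _] MJ; exact: topM.
split=> //; apply/seteqP; split=> [z [F [[_ [t ->]] _ tM] zt]|_ [d Md <-]].
- have [s [tE sM]] : exists s, t = map (@tofrac D) s /\ [set` s] `<=` M.
    have : forall x, x \in t -> emb M x by move=> x xt; apply/tM/mem_Dspan.
    elim: t {tM zt} => [|x t IHt] tM; first by exists [::]; split=> // ?.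
    have [y yt|s [-> sM]] := IHt; first by apply: tM; rewrite inE yt orbT.
    have [a Ma <-] := tM x (mem_head _ _); exists (a :: s); split=> // b /=.
    by rewrite inE => /orP [/eqP ->|/sM].
  have [c _ cz] : range (@tofrac D) z.
    rewrite -[z]mulr1; apply: zt; apply: colonD_Dspan => x; rewrite tE mul1r.
    by move=> /mapP [a _ ->]; exists a.
  rewrite -cz; apply/emb_mem; apply: contrapT => Mc.
  have [m [a [Mm bez]]] := maximal_ideal_bezout maxM Mc.
  have [|y [Dy ys]] := colonM (m :: s).
    by move=> b /=; rewrite inE => /orP [/eqP ->|/sM].
  apply: Dy; rewrite -[y]mulr1 -tofrac1 -bez tofracD mulrDr tofracM mulrCA cz.
  apply: (RD); first by apply: ys; exact: mem_head.
  apply: RM; first by exists a.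
  rewrite mulrC; apply: zt; apply: colonD_Dspan => x; rewrite tE => /mapP [b bs ->].
  by apply: ys; rewrite inE bs orbT.
- have [m Mm m0] := exists_nonzero idM Mn0.
  pose t := map (@tofrac D) [:: m; d]; exists (Dspan t); last first.
    by apply: sub_v_closure; apply: mem_Dspan; rewrite !inE eqxx orbT.
  split; first exact: fg_fractional_Dspan.
    move=> t0; have : Dspan t m%:F by apply: mem_Dspan; exact: mem_head.
    by rewrite t0 => /eqP; rewrite tofrac_eq0 (negbTE m0).
  apply: Dspan_sub => [|x]; first exact: is_submod_emb.
  by rewrite !inE => /orP [] /eqP ->; apply/emb_mem.
Qed.

(** Let P be a prime inside M that is minimal over xD and contains s. A
    product of witnesses of minimality gives h outside P, hence outside xD,
    such that high powers of each f in s send h into xD; after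
    [residual_of_radical], h / x is outside D and maps s into D. *)
Lemma treed_Max_t M : treed D -> is_maximal_ideal M -> M <> [set 0] -> Max_t M.
Proof.
move=> treedD maxM Mn0; apply: maximal_Max_t => // s sM.
have [P [x [[primeP PM Px x0 sP] minP]]] :=
  treed_finite_subset treedD (maximal_is_prime maxM) Mn0 sM.
have [[[P0 PD PP] P1] Pprime] := primeP.
have [h [Ph hs]] : exists h, ~ P h /\
    forall f, f \in s -> exists n c, h * f ^+ n = c * x.
  elim: s {sM} sP => [|f s IHs] sP; first by exists 1.
  have [b bs|h [Ph hs]] := IHs; first by apply: sP; rewrite /= inE [_ \in _]bs orbT.
  have [k [n [c [Pk e]]]] := minP f (sP f (mem_head _ _)).
  exists (h * k); split=> [/Pprime []|g] //.
  rewrite inE => /orP [/eqP ->|/hs [m [d e']]].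
    by exists n, (h * c); rewrite -mulrA e mulrA.
  by exists m, (d * k); rewrite mulrAC e' mulrAC.
have hx c : h <> c * x by move=> e; apply: Ph; rewrite e; exact: PP.
have [a [ax as_]] := residual_of_radical hx hs.
have xF : x%:F != 0 by rewrite tofrac_eq0.
exists ((a * h)%:F / x%:F); split.
  move=> [c _ e]; apply: (ax c); apply/eqP; rewrite -tofrac_eq [(c * x)%:F]tofracM e.
  by rewrite divfK.
move=> f /as_ [c e]; exists c => //; rewrite mulrAC -tofracM e tofracM mulfK //.
Qed.

Lemma exists_denominator x : exists2 b : D, b != 0 & range (@tofrac D) (b%:F * x).
Proof.
elim/quotW: x => r; exists \d_r; first exact: denom_ratioP.
exists \n_r => //; unlock tofrac; rewrite -[RHS]FracField.pi_mul.
apply/eqmodP; rewrite /= FracField.equivfE /FracField.mulf.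
by rewrite !numden_Ratio ?(oner_neq0, mul1r, denom_ratioP) //= mulrC.
Qed.

(** Let x be in the w-closure of E. The ideal A of the d with d x in E lies in
    no maximal ideal M: being in E D_M, the element x is multiplied into E by
    some s outside M. Such an M would be nonzero because x / e has a
    denominator for each nonzero e in E. *)
Lemma DW_domain_of_Max_t :
  (forall M, is_maximal_ideal M -> M <> [set 0] -> Max_t M) -> DW_domain D.
Proof.
move=> maxt E [[E0 ED EM] En0]; apply/seteqP; split=> [x Ex|x Ex Q [[[_ Q1] _ _] _]].
- pose A := [set d : D | E (d%:F * x)].
  have idA : is_ideal A.
    split; first by rewrite /A /= tofrac0 mul0r.
      by move=> a b Aa Ab; rewrite /A /= tofracD mulrDl; exact: ED.
    by move=> a b Ab; rewrite /A /= tofracM -mulrA; exact: EM.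
  have [A1|A1] := pselect (A 1); first by rewrite /A /= tofrac1 mul1r in A1.
  have [M [AM maxM]] := exists_maximal_ideal (conj idA A1).
  have [primeM [_ M1]] := (maximal_is_prime maxM, maxM.1).
  have [e Ee e0] : exists2 e, E e & e != 0.
    apply: contrapT => nE; apply: En0; apply/seteqP; split=> [e Ee|e ->] //=.
    by apply: contrapT => /eqP e0; apply: nE; exists e.
  have [b b0 [a _ ab]] := exists_denominator (x / e).
  have Ab : A b by rewrite /A /= -[x](divfK e0) mulrA -ab; exact: EM.
  have Mn0 := nonzero_ideal (AM b Ab) b0.
  have [s [Ms Es]] : exists s : D, ~ M s /\ E (s%:F * x).
    have := Ex M (maxt M maxM Mn0).
    apply: (@prodm_sub _ _ _ [set z | exists s : D, ~ M s /\ E (s%:F * z)]) => /=.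
    + by exists 1; rewrite mulr0.
    + move=> u v [s [Ms Es]] [t [Mt Et]]; exists (s * t); split.
        by move=> /primeM.2 [].
      rewrite mulrDr tofracM; apply: ED; last by rewrite -mulrA; exact: EM.
      by rewrite mulrAC mulrC; exact: EM.
    + move=> u v Eu [c [s [Ms ->]]]; exists s; split=> //.
      have s0 : s%:F != 0.
        rewrite tofrac_eq0; apply/eqP => s0; apply: Ms; rewrite s0.
        by have [[[]]] := primeM.
      have -> : s%:F * (u * (c%:F / s%:F)) = c%:F * u by field.
      exact: EM.
  by case: Ms; apply: AM.
- rewrite -[x]mulr1; apply: mem_prodm => //; exists 1, 1; split=> //.
  by rewrite divff // tofrac1 oner_neq0.
Qed.

(** Since 1 is not in M, it is missing from M D_Q for some Q in [Max_t D];
    then M is contained in Q, and M = Q by maximality. *)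
Lemma Max_t_of_DW_domain M :
  DW_domain D -> is_maximal_ideal M -> M <> [set 0] -> Max_t M.
Proof.
move=> DW maxM Mn0; have [[idM M1] topM] := maxM.
have nzM : nz_submod (emb M).
  split; first exact: is_submod_emb.
  have [m Mm m0] := exists_nonzero idM Mn0.
  move=> M0; have : emb M m%:F by exists m.
  by rewrite M0 => /eqP; rewrite tofrac_eq0 (negbTE m0).
apply: contrapT => nMax; apply: M1; apply/emb_mem; rewrite -(DW _ nzM) => Q maxQ.
have [m Mm Qm] : exists2 m, M m & ~ Q m.
  apply: contrapT => MQ; apply: nMax; rewrite -(topM Q) //; first by case: maxQ => -[].
  by move=> m Mm; apply: contrapT => Qm; apply: MQ; exists m.
have m0 : m != 0.
  by apply/eqP => m0; apply: Qm; rewrite m0; case: maxQ => -[[[]]].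
have -> : 1%:F = m%:F * (1%:F / m%:F) by rewrite mulrC divfK // tofrac_eq0.
by apply: mem_prodm; [apply/emb_mem|exists 1, m].
Qed.

End MaximalTIdeals.

(** * Invertibility of ideals *)

Section Dedekind.
Variable D : idomainType.
Local Notation K := {fraction D}.
Local Notation "x %:F" := (@tofrac D x) : ring_scope.
Implicit Types (I J M P : set D) (x y z : K).

(** If y I is contained in D, then y times I V is contained in V. *)
Lemma b_closure_sub_v_closure I : integrally_closed D ->
  b_closure (emb I) `<=` v_closure (emb I).
Proof.
move=> icD x Ix y yI; apply: mem_of_all_valuation_overrings => // V valV.
have [/overring_closed [DV V0 _ VD VM] _] := valV; rewrite mulrC.
apply: (@prodm_sub _ _ _ [set z | V (y * z)]) (Ix V valV) => /=.
- by rewrite mulr0.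
- by move=> u v Vu Vv; rewrite mulrDr; exact: VD.
- by move=> u v /yI [c _ e] Vv; rewrite mulrA -e; exact: VM.
Qed.

(** A finite subset s of M has the same multipliers into D as M, and one of
    them is not in D because M is a t-ideal. *)
Lemma maximal_colon_proper M : b_noetherian D -> integrally_closed D ->
  (forall M, is_maximal_ideal M -> M <> [set 0] -> Max_t M) ->
  is_maximal_ideal M -> M <> [set 0] ->
  exists y, ~ range (@tofrac D) y /\ colonD (emb M) y.
Proof.
move=> bN icD maxt maxM Mn0; have [[idM _] _] := maxM.
have [s [sM sP]] := b_noetherian_colon_finite bN icD idM Mn0.
have [tM _] := maxt M maxM Mn0.
by have [y [Dy ys]] := proper_t_ideal_colon tM sM; exists y; split=> //; exact: sP.
Qed.

(** If J = I (D : I) is proper, it lies in a maximal ideal M; take y outside D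
    with y M inside D. Then y J is inside D, that is, y maps (D : I) into
    itself. Scaling (D : I) by a nonzero d in I gives an ideal I' with y I'
    inside I', so y is in D, a contradiction. *)
Lemma ideal_invertible I : b_noetherian D -> integrally_closed D ->
  (forall M, is_maximal_ideal M -> M <> [set 0] -> Max_t M) ->
  is_ideal I -> I <> [set 0] ->
  prodm (emb I) (colonD (emb I)) 1.
Proof.
move=> bN icD maxt idI In0; have [R0 R1 RD RM] := range_tofrac_closed D.
have [C0 CD CM] := is_submod_colonD (emb I).
pose J := [set d | prodm (emb I) (colonD (emb I)) d%:F].
have idJ : is_ideal J.
  split; rewrite /J /=; first by rewrite tofrac0; exact: prodm0.
    by move=> a b; rewrite tofracD; exact: prodmD.
  by move=> a b Jb; rewrite tofracM; apply: prodm_scale Jb => y; exact: CM.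
rewrite -(tofrac1 D); apply: contrapT => J1.
have [M [JM maxM]] := exists_maximal_ideal (conj idJ J1).
have IJ : I `<=` J.
  move=> d Id; rewrite /J /= -[_%:F]mulr1; apply: mem_prodm; first by exists d.
  by move=> _ [a _ <-]; rewrite mul1r; exists a.
have [d Id d0] := exists_nonzero idI In0.
have dF : d%:F != 0 by rewrite tofrac_eq0.
have [y [Dy yM]] :=
  maximal_colon_proper bN icD maxt maxM (nonzero_ideal (JM d (IJ d Id)) d0).
have yC z : colonD (emb I) z -> colonD (emb I) (y * z).
  move=> zI _ [a Ia <-]; rewrite -mulrA [z * _]mulrC.
  have [c _ e] := zI a%:F (ex_intro2 _ _ a Ia erefl).
  apply: yM; exists c; last by rewrite e mulrC.
  by apply: JM; rewrite /J /= e mulrC; apply: mem_prodm => //; exists a.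
pose I' := [set e | colonD (emb I) (e%:F / d%:F)].
apply: Dy; apply: (b_noetherian_colon_self bN icD (I := I')).
- split; rewrite /I' /=; first by rewrite tofrac0 mul0r.
    by move=> a b Ia Ib; rewrite tofracD mulrDl; exact: CD.
  by move=> a b Ib; rewrite tofracM -mulrA; exact: CM.
- apply: (nonzero_ideal (d := d)) => //; rewrite /I' /= divff //.
  by move=> _ [a _ <-]; rewrite mul1r; exists a.
- move=> e /yC ye; have [c _ ce] := ye d%:F (ex_intro2 _ _ d Id erefl).
  exists c; last by rewrite ce mulrA divfK.
  by rewrite /I' /= ce mulfK.
Qed.

(** If 1 is the sum of the a_i y_i with a_i in I and y_i in (D : I), then
    every d in the v-closure of I is the sum of the a_i (y_i d), an element of
    I. *)
Lemma ideal_quasi_b I : b_noetherian D -> integrally_closed D ->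
  (forall M, is_maximal_ideal M -> M <> [set 0] -> Max_t M) ->
  is_ideal I -> I <> [set 0] -> quasi_b_ideal I.
Proof.
move=> bN icD maxt idI In0; split=> //.
apply/seteqP; split; last exact: sub_quasi_b_closure.
move=> d /(b_closure_sub_v_closure icD) dI; apply/emb_mem; rewrite -[d%:F]mulr1.
have [E0 ED EM] := is_submod_emb idI.
have inv := ideal_invertible bN icD maxt idI In0.
apply: (@prodm_sub _ _ _ [set z | emb I (d%:F * z)]) inv => /=.
- by rewrite mulr0.
- by move=> u v; rewrite mulrDr; exact: ED.
- by move=> u v Iu /dI [c _ e]; rewrite mulrCA -e mulrC; exact: EM.
Qed.

(** Quasi-b-ideals are nonzero, so the chain is shifted past its zeros. *)
Lemma noetherian_of_maximal_t : b_noetherian D -> integrally_closed D ->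
  (forall M, is_maximal_ideal M -> M <> [set 0] -> Max_t M) ->
  noetherian D.
Proof.
move=> bN icD maxt I idI incI.
have [[k Ik0]|allI0] := pselect (exists k, I k <> [set 0]); last first.
  have I0 n : I n = [set 0] by apply: contrapT => In0; apply: allI0; exists n.
  by exists 0%N => n _; rewrite !I0.
have mono m n : (m <= n)%N -> I m `<=` I n.
  move=> mn; rewrite -(subnKC mn); elim: (n - m)%N => [|l IHl]; first by rewrite addn0.
  by rewrite addnS; apply: subset_trans IHl _; exact: incI.
have [d Id d0] := exists_nonzero (idI k) Ik0.
have [n|n|N NP] := bN (fun n => I (k + n)%N).
- by apply: ideal_quasi_b => //; apply: nonzero_ideal d0; apply: mono Id; exact: leq_addr.
- by rewrite addnS; exact: incI.
- exists (k + N)%N => n kNn.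
  have kn := leq_trans (leq_addr N k) kNn.
  by rewrite -(subnKC kn) NP // leq_subRL.
Qed.

(** Let J be a proper ideal strictly containing P, and j in J outside P. For y
    in (D : J) and q in P, j (y q) = (y j) q is in P, so y q is in P. Thus y
    is in D, and J (D : J) is inside J, whereas it contains 1. *)
Lemma prime_maximal P : b_noetherian D -> integrally_closed D ->
  (forall M, is_maximal_ideal M -> M <> [set 0] -> Max_t M) ->
  is_prime_ideal P -> P <> [set 0] -> is_maximal_ideal P.
Proof.
move=> bN icD maxt [[idP P1] Pprime] Pn0; split=> // J [idJ J1] PJ.
apply/seteqP; split=> // j Jj; apply: contrapT => Pj; apply: J1.
have [p Pp p0] := exists_nonzero idP Pn0.
have Jn0 := nonzero_ideal (PJ p Pp) p0.
have [E0 ED EM] := is_submod_emb idJ.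
apply/emb_mem; rewrite tofrac1.
apply: prodm_sub (ideal_invertible bN icD maxt idJ Jn0) => // x y Jx yJ; rewrite mulrC.
have [c _ <-] : range (@tofrac D) y; last exact: EM.
apply: (b_noetherian_colon_self bN icD idP Pn0) => q Pq.
have [c _ ce] := yJ q%:F (ex_intro2 _ _ q (PJ q Pq) erefl).
have [e _ ee] := yJ j%:F (ex_intro2 _ _ j Jj erefl).
rewrite -ce; apply/emb_mem; have [|//|/Pj//] := Pprime c j.
have -> : c * j = e * q.
  by apply/eqP; rewrite -tofrac_eq !tofracM ce ee mulrAC.
by have [_ _ PM] := idP; exact: PM.
Qed.

End Dedekind.

(** * The equivalence *)

Theorem proposition23 (D : idomainType) :
  [<-> [/\ b_noetherian D, integrally_closed D & treed D];
       [/\ b_noetherian D, integrally_closed D & DW_domain D];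
       dedekind D].
Proof.
tfae.
- move=> [bN icD treedD]; split=> //; apply: DW_domain_of_Max_t => M.
  exact: treed_Max_t.
- move=> [bN icD DW]; have maxt := fun M => @Max_t_of_DW_domain D M DW.
  split=> //; first exact: noetherian_of_maximal_t.
  by move=> P; exact: prime_maximal.
- move=> [noethD icD primeD]; split=> //.
    by move=> I quasiI; apply: noethD => n; have [] := quasiI n.
  move=> P1 P2 P primeP1 primeP2 primeP P1P P2P.
  have [P10|P1n0] := pselect (P1 = [set 0]).
    by left; rewrite P10 => _ ->; have [[[]]] := primeP2.
  right; have [_ topP1] := primeD P1 primeP1 P1n0.
  by rewrite -(topP1 P) //; case: primeP.
Qed.
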